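(* Let $H\in C^1(\Omega,S(m))$ with repeated eigenvalues $\lambda_i(x)$ and eigenprojections $P_i(x)$, $i=1,\dots,m$. Let $j\in\{1,2,\dots,m\}$ and assume that $\operatorname{tr}P_j$ is constant in $\Omega$. Then $P_j$ is directionally differentiable in $\Omega$ with \[\mathrm{D}_e P_j(x) = P_j(x)\,\mathrm{D}_e H(x)\,A_j(x) + A_j(x)\,\mathrm{D}_e H(x)\,P_j(x)\] for all $x\in\Omega$ and all $e\in\mathbb{R}^n$.
   Context: $\Omega\subseteq\mathbb{R}^n$ is a domain (nonempty, open, connected) and $S(m)$ is the space of real symmetric $m\times m$ matrices. For $x\in\Omega$, $\lambda_1(x)\le\cdots\le\lambda_m(x)$ are the eigenvalues of $H(x)$ repeated according to multiplicity. The eigenprojection $P_i(x)$ is the symmetric matrix of the orthogonal projection of $\mathbb{R}^m$ onto the full eigenspace $\{\xi\in\mathbb{R}^m: H(x)\xi=\lambda_i(x)\xi\}$; thus $P_i(x)=P_k(x)$ when $\lambda_i(x)=\lambda_k(x)$, and $d_i(x):=\operatorname{tr}P_i(x)$ is the multiplicity of $\lambda_i(x)$. Define \[A_j(x) := \sum_{\substack{1\le i\le m\\ \lambda_i(x)\ne\lambda_j(x)}}\frac{P_i(x)/d_i(x)}{\lambda_j(x)-\lambda_i(x)}\in S(m)\] (an empty sum is zero). For a matrix-valued function $F$ on $\Omega$, the directional derivative is the two-sided limit $\mathrm{D}_eF(x):=\lim_{h\to0}\frac{F(x+he)-F(x)}{h}$, $e\in\mathbb{R}^n$; $F$ is directionally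 differentiable in $\Omega$ if this limit exists for every $x\in\Omega$ and every $e\in\mathbb{R}^n$. *)

(* Defs.v *)
From HB Require Import structures.
From mathcomp Require Export all_boot all_order all_algebra.
From mathcomp Require Export all_classical all_reals all_analysis.

Set Implicit Arguments.
Unset Strict Implicit.
Unset Printing Implicit Defensive.

Import Order.TTheory GRing.Theory Num.Theory.
Export numFieldNormedType.Exports.

Local Open Scope classical_set_scope.
Local Open Scope ring_scope.

Definition is_domain (R : realType) (n : nat) (Omega : set 'rV[R]_n) : Prop :=
  [/\ Omega !=set0, open Omega & connected Omega].

(* The k-th partial derivative is the derivative along the k-th vector of the
   standard basis. *)
Definition is_C1 (R : realType) (n : nat) (W : normedModType R)
    (Omega : set 'rV[R]_n) (F : 'rV[R]_n -> W) : Prop :=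
  forall k : 'I_n,
    (forall x, Omega x -> derivable F x (delta_mx 0 k)) /\
    {within Omega, continuous (fun x => 'D_(delta_mx 0 k) F x)}.

(* Equality with the characteristic polynomial counts the eigenvalues with
   multiplicity; together with monotonicity it determines l uniquely. *)
Definition ordered_eigenvalues (R : realType) (m : nat) (A : 'M[R]_m)
    (l : 'I_m -> R) : Prop :=
  (forall i k : 'I_m, (i <= k)%N -> l i <= l k) /\
  char_poly A = \prod_(i < m) ('X - (l i)%:P).

(* Orthogonal projection onto the row space of U: the rows of kermx U^T span
   the orthogonal complement. *)
Definition orthoproj (R : realType) (m : nat) (U : 'M[R]_m) : 'M[R]_m :=
  proj_mx U (kermx U^T).

(* MathComp eigenspaces consist of row vectors, hence the transpose: the row
   space of eigenspace A^T a is {xi^T | A xi = a xi}; see eigenprojP. *)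
Definition eigenproj (R : realType) (m : nat) (A : 'M[R]_m) (a : R) : 'M[R]_m :=
  orthoproj (eigenspace A^T a).

Definition reduced_resolvent (R : realType) (m : nat) (A : 'M[R]_m)
    (l : 'I_m -> R) (j : 'I_m) : 'M[R]_m :=
  \sum_(i < m | l i != l j)
    (l j - l i)^-1 *: ((\tr (eigenproj A (l i)))^-1 *: eigenproj A (l i)).

Section OrthogonalProjection.
Variables (R : realType) (m : nat).
Implicit Types (U A P : 'M[R]_m) (a : R).

Lemma mulmx_trmx_eq0 (p : nat) (V : 'M[R]_(p, m)) : V *m V^T = 0 -> V = 0.
Proof.
move=> VV0; apply/matrixP => i k; rewrite mxE.
have /matrixP/(_ i i) := VV0; rewrite !mxE => s0.
have /eqP : \sum_(q < m) V i q ^+ 2 = 0.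
  by rewrite -[RHS]s0; apply: eq_bigr => q _; rewrite mxE expr2.
rewrite psumr_eq0 => [|q _]; last exact: sqr_ge0.
by move=> /allP/(_ k (mem_index_enum _)) /=; rewrite sqrf_eq0 => /eqP.
Qed.

Lemma capmx_ortho U : (U :&: kermx U^T)%MS = 0.
Proof.
apply: mulmx_trmx_eq0; set W := (_ :&: _)%MS.
have /submxP[D WD] : (W <= U)%MS by exact: capmxSl.
have /sub_kermxP WU : (W <= kermx U^T)%MS by exact: capmxSr.
by rewrite {2}WD trmx_mul mulmxA WU mul0mx.
Qed.

Lemma addsmx_ortho U : (1%:M <= U + kermx U^T)%MS.
Proof.
rewrite sub1mx /row_full mxrank_disjoint_sum ?capmx_ortho //.
by rewrite mxrank_ker mxrank_tr subnKC // rank_leq_row.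
Qed.

Lemma orthoproj_sub U (p : nat) (V : 'M[R]_(p, m)) : (V *m orthoproj U <= U)%MS.
Proof. exact: proj_mx_sub. Qed.

Lemma orthoproj_compl U (p : nat) (V : 'M[R]_(p, m)) :
  (V - V *m orthoproj U) *m U^T = 0.
Proof.
apply/sub_kermxP; apply: proj_mx_compl_sub.
by apply: submx_trans (addsmx_ortho U); exact: submx1.
Qed.

Lemma orthoproj_sym U : (orthoproj U)^T = orthoproj U.
Proof.
have /submxP[D PD] : (orthoproj U <= U)%MS.
  by rewrite -[X in (X <= _)%MS]mul1mx orthoproj_sub.
have := orthoproj_compl U 1%:M; rewrite mul1mx => PU.
have e : orthoproj U *m (orthoproj U)^T = (orthoproj U)^T.
  apply/esym/eqP; rewrite -subr_eq0 -{1}[(_)^T]mul1mx -mulmxBl.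
  by rewrite {2}PD trmx_mul mulmxA PU mul0mx.
by have := congr1 trmx e; rewrite trmx_mul !trmxK e.
Qed.

Lemma eigenprojP A a :
  [/\ (eigenproj A a)^T = eigenproj A a,
      forall v : 'cV[R]_m,
        A *m (eigenproj A a *m v) = a *: (eigenproj A a *m v) &
      forall v w : 'cV[R]_m, A *m w = a *: w ->
        (v - eigenproj A a *m v)^T *m w = 0].
Proof.
have sP : (eigenproj A a)^T = eigenproj A a by exact: orthoproj_sym.
split=> // [v|v w Aw].
  have /eigenspaceP := orthoproj_sub (eigenspace A^T a) v^T.
  rewrite -/(eigenproj A a) => e; apply: trmx_inj.
  by rewrite linearZ/= trmx_mul trmx_mul sP e.
have /submxP[D wD] : (w^T <= eigenspace A^T a)%MS.
  by apply/eigenspaceP; rewrite -trmx_mul Aw linearZ.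
rewrite -[w]trmxK wD trmx_mul mulmxA linearB/= trmx_mul sP.
by rewrite orthoproj_compl mul0mx.
Qed.

End OrthogonalProjection.

(* Main.v *)
Require Import Defs.
From mathcomp Require Import perm lra.

Set Implicit Arguments.
Unset Strict Implicit.
Unset Printing Implicit Defensive.

Import Order.TTheory GRing.Theory Num.Theory.
Import numFieldNormedType.Exports.

Local Open Scope classical_set_scope.
Local Open Scope ring_scope.

(* Write H, P, Q = 1 - P for the values at x, and H', P', l' for those of H, P_j
   and lambda_j at x + he.  With
   R(mu) = sum_(lambda_i <> lambda_j) (mu - lambda_i)^-1 P_i / d_i one has
   R(l') (l' - H) = Q, hence Q P' = R(l') (l' - H) P' = R(l') (H' - H) P'.
   Since l' -> lambda_j by Weyl's inequality, R(l') -> A, so Q P' -> 0 and, once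
   P' -> P is known, Q P' / h -> A (D_e H) P.
   The remaining part of P' - P = Q P' + (Q P' P)^T - P (1 - P') P is controlled
   by the trace: P (1 - P') P is a Gram matrix, so its entries are bounded by
   its trace, which equals tr (Q P') because tr P' = tr P.  This gives P' -> P
   first, and then the derivative, as tr (A (D_e H) P) = 0. *)

(** * Diagonalization of symmetric matrices with split characteristic polynomial *)

(** Powers of [B] are symmetric, so [B ^+ k.+2 = 0] makes the Gram matrix of [B ^+ k.+1] vanish; the
    exponent thus descends to 1. *)
Lemma symmx_nilp_eq0 (R : realType) (m k : nat) (B : 'M[R]_m.+1) :
  B^T = B -> B ^+ k = 0 -> B = 0.
Proof.
move=> sB; elim/ltn_ind: k => -[|[|k]] IHk Bk0; last 2 first.
- by rewrite expr1 in Bk0.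
- apply: (IHk k.+1) => //; apply: mulmx_trmx_eq0.
  have -> : (B ^+ k.+1)^T = B ^+ k.+1.
    elim: k.+1 => [|i IHi]; first by rewrite expr0 trmx1.
    by rewrite {1}exprS trmx_mul IHi sB [RHS]exprSr.
  have -> : B ^+ k.+1 *m B ^+ k.+1 = B ^+ k.+2 * B ^+ k.
    by rewrite -[LHS]/(_ * _) -!exprD; congr (_ ^+ _); rewrite !addSn addnS.
  by rewrite Bk0 mul0r.
- by rewrite -[B]mulr1 -(expr0 B) Bk0 mulr0.
Qed.

Lemma horner_mx_sym (R : comNzRingType) (m : nat) (A : 'M[R]_m.+1) (p : {poly R}) :
  A^T = A -> (horner_mx A p)^T = horner_mx A p.
Proof.
move=> sA; elim/poly_ind: p => [|p c IHp]; first by rewrite rmorph0 trmx0.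
rewrite rmorphD rmorphM /= horner_mx_X horner_mx_C linearD /= tr_scalar_mx.
rewrite trmx_mul IHp sA; congr (_ + _); apply/esym.
by have := congr1 (horner_mx A) (mulrC p 'X); rewrite !rmorphM /= horner_mx_X.
Qed.

Lemma symmx_diagonalizable (R : realType) (m : nat) (A : 'M[R]_m) (l : 'I_m -> R) :
  A^T = A -> char_poly A = \prod_(i < m) ('X - (l i)%:P) -> diagonalizable A.
Proof.
case: m A l => [|m] A l sA Al.
  by exists 1%:M; [exact: unitmx1 | apply/is_diag_mxP => -[]].
apply/diagonalizableP; exists (undup (codom l)); first exact: undup_uniq.
(* By Cayley-Hamilton p(A) is nilpotent; being symmetric, it vanishes. *)
apply: mxminpoly_min; set p := \prod_(_ <- _) _.
apply: (@symmx_nilp_eq0 _ _ m.+1); first exact: horner_mx_sym.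
(* [p] keeps one copy of every root, so each of the [m.+1] linear factors of [char_poly A] divides
   [p]. *)
have /Pdiv.Field.dvdpP[q pq] : char_poly A %| p ^+ m.+1.
  rewrite Al -[X in p ^+ X]card_ord -prodr_const.
  apply: (big_ind2 (fun a b => a %| b)); rewrite ?dvdpp//.
    by move=> a b c d; exact: Pdiv.Idomain.dvdp_mul.
  move=> i _; rewrite Pdiv.Idomain.dvdp_XsubCl root_prod_XsubC mem_undup.
  exact: codom_f.
by rewrite -rmorphXn /= pq rmorphM /= Cayley_Hamilton mulr0.
Qed.

(** The similarity lifts to the characteristic matrices over polynomials, where the nonzero constant
    [\det Up] cancels from the determinants. *)
Lemma char_poly_similar (F : fieldType) (m : nat) (U A B : 'M[F]_m) :
  U \in unitmx -> U *m A = B *m U -> char_poly A = char_poly B.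
Proof.
move=> Uu UA; set Up := map_mx polyC U.
have UpA : Up *m char_poly_mx A = char_poly_mx B *m Up.
  by rewrite /char_poly_mx mulmxBr mulmxBl scalar_mxC -!map_mxM UA.
have Up0 : \det Up != 0.
  by rewrite det_map_mx polyC_eq0 -unitfE -unitmxE.
apply: (mulfI Up0); rewrite /char_poly -det_mulmx UpA det_mulmx mulrC //.
Qed.

(** Diagonalization yields the eigenvalues in an unknown order [d]; unique factorization of the
    characteristic polynomial gives the permutation that matches [d] with [l]. An invertible [V]
    suffices below; orthogonality is not claimed. *)
Lemma symmx_eigenbasis (R : realType) (m : nat) (A : 'M[R]_m) (l : 'I_m -> R) :
  A^T = A -> char_poly A = \prod_(i < m) ('X - (l i)%:P) ->
  exists2 V, V \in unitmx & A *m V = V *m diag_mx (\row_i l i).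
Proof.
move=> sA Al; have [U Uu /similar_diagPex[d /(similarP Uu) UA]] :=
  symmx_diagonalizable sA Al.
have dA : char_poly A = \prod_(i < m) ('X - (d 0 i)%:P).
  rewrite (char_poly_similar Uu UA).
  rewrite char_poly_trig ?diag_mx_is_trig//.
  by apply: eq_bigr => i _; rewrite mxE eqxx.
have /tuple_permP[s ds] : perm_eq [tuple l i | i < m] [tuple d 0 i | i < m].
  apply: prod_XsubC_eq; rewrite !big_tuple.
  under eq_bigr do rewrite tnth_mktuple.
  under [RHS]eq_bigr do rewrite tnth_mktuple.
  by rewrite -Al -dA.
exists (row_perm s U)^T; first by rewrite unitmx_tr row_permE unitmx_mul unitmx_perm.
apply: trmx_inj; rewrite !trmx_mul !trmxK tr_diag_mx sA.
apply/row_matrixP => i; rewrite !row_mul row_diag_mx -scalemxAl -rowE mxE.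
have -> : row i (row_perm s U) = row (s i) U by apply/rowP => k; rewrite !mxE.
rewrite -row_mul UA row_mul row_diag_mx -scalemxAl -rowE.
suff -> : l i = d 0 (s i) by [].
have : tnth [tuple l i | i < m] i =
    tnth [tuple tnth [tuple d 0 i | i < m] (s i) | i < m] i.
  by congr (tnth _ i); apply/val_inj.
by rewrite !tnth_mktuple.
Qed.

(** * Algebra of eigenprojections *)

Lemma mulmx_cV_inj (R : nzRingType) (p q : nat) (X Y : 'M[R]_(p, q)) :
  (forall v : 'cV_q, X *m v = Y *m v) -> X = Y.
Proof.
move=> XY; apply: trmx_inj; apply/row_matrixP => i.
by apply: trmx_inj; rewrite !tr_row !trmxK !colE XY.
Qed.

Section Eigenprojections.
Context {R : realType} {m : nat}.
Implicit Types (A B : 'M[R]_m) (l : 'I_m -> R).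

Lemma eigenproj_sym A a : (eigenproj A a)^T = eigenproj A a.
Proof. exact: orthoproj_sym. Qed.

Lemma mul_eigenprojr A a : A *m eigenproj A a = a *: eigenproj A a.
Proof.
apply: mulmx_cV_inj => v; have [_ AP _] := eigenprojP A a.
by rewrite -mulmxA AP scalemxAl.
Qed.

Lemma mul_eigenprojl A a : A^T = A -> eigenproj A a *m A = a *: eigenproj A a.
Proof.
move=> sA; apply: trmx_inj.
by rewrite trmx_mul sA eigenproj_sym mul_eigenprojr linearZ /= eigenproj_sym.
Qed.

(** Let [P] be the eigenprojection. If [b = a], then [w] and [P w] lie in the eigenspace, so
    [w - P w] is orthogonal to both and hence to itself. Otherwise, computing [P A w] in two ways
    gives [(b - a) P w = 0]. *)
Lemma eigenproj_eigenvector A a b (w : 'cV[R]_m) :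
  A^T = A -> A *m w = b *: w -> eigenproj A a *m w = (b == a)%:R *: w.
Proof.
move=> sA Aw; have [ba|ab] := eqVneq b a.
  rewrite scale1r; have [_ AP orthP] := eigenprojP A a.
  set u := w - eigenproj A a *m w.
  suff /(congr1 trmx) : u^T = 0.
    by rewrite trmxK trmx0 => /eqP; rewrite subr_eq0 eq_sym => /eqP.
  apply: mulmx_trmx_eq0; rewrite trmxK {2}/u mulmxBr.
  by rewrite !orthP ?subrr // Aw ba.
rewrite scale0r; apply/eqP.
have : (b - a) *: (eigenproj A a *m w) = 0.
  have PA : eigenproj A a *m A *m w = a *: (eigenproj A a *m w).
    by rewrite mul_eigenprojl // -scalemxAl.
  by rewrite scalerBl -PA -mulmxA Aw -scalemxAr subrr.
by move/eqP; rewrite scaler_eq0 subr_eq0 (negPf ab).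
Qed.

Lemma eigenproj_mulV A l V a : A^T = A -> A *m V = V *m diag_mx (\row_i l i) ->
  eigenproj A a *m V = V *m diag_mx (\row_i (l i == a)%:R).
Proof.
move=> sA AV; apply: trmx_inj; apply/row_matrixP => k; apply: trmx_inj.
have colV (d : 'I_m -> R) (X : 'M[R]_m) : X *m V = V *m diag_mx (\row_i d i) ->
    X *m col k V = d k *: col k V.
  move=> XV; rewrite [in LHS]colE mulmxA XV -colE; apply/colP => i.
  by rewrite mul_mx_diag !mxE mulrC.
rewrite !tr_row !trmxK [LHS]colE -mulmxA -colE
  (eigenproj_eigenvector _ sA (colV _ _ AV)).
by apply/colP => i; rewrite mul_mx_diag !mxE mulrC.
Qed.

Definition eigenmult l (a : R) : nat := #|[pred i | l i == a]|.

Lemma eigenmult_gt0 l i : (0 < eigenmult l (l i))%N.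
Proof. by apply/card_gt0P; exists i; rewrite inE. Qed.

Section Spectrum.
Context {A l}.
Hypotheses (sA : A^T = A) (Al : char_poly A = \prod_(i < m) ('X - (l i)%:P)).

Lemma mxtrace_eigenproj a : \tr (eigenproj A a) = (eigenmult l a)%:R.
Proof.
have [V Vu AV] := symmx_eigenbasis sA Al.
rewrite -[eigenproj A a](mulmxK Vu) (eigenproj_mulV _ sA AV) mxtrace_mulC mulKmx //.
rewrite mxtrace_diag /eigenmult -sum1_card natr_sum [RHS]big_mkcond /=.
by apply: eq_bigr => i _; rewrite mxE inE; case: (l i == a).
Qed.

(** The sum runs over indices, so each projection occurs as often as its eigenvalue is repeated; the
    inverse trace compensates for this. *)
Lemma sum_eigenproj :
  \sum_i (\tr (eigenproj A (l i)))^-1 *: eigenproj A (l i) = 1%:M.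
Proof.
have [V Vu AV] := symmx_eigenbasis sA Al.
apply: (can_inj (mulmxK Vu)); rewrite mulmx_suml mul1mx.
under eq_bigr do rewrite -scalemxAl (eigenproj_mulV _ sA AV) mxtrace_eigenproj.
apply/matrixP => i k; rewrite summxE.
under eq_bigr do rewrite mxE mul_mx_diag !mxE mulrCA.
rewrite -mulr_sumr
  (eq_bigr (fun p => if l p == l k then (eigenmult l (l k))%:R^-1 else 0)).
  rewrite -big_mkcond /= sumr_const -[X in _ *+ X]/(eigenmult l (l k)).
  by rewrite -[X in _ * X]mulr_natr mulVf ?mulr1 // pnatr_eq0 -lt0n eigenmult_gt0.
by move=> p _; rewrite eq_sym; case: eqP => [->|]; rewrite ?mulr1 ?mulr0.
Qed.

Lemma mul_eigenproj_neq a b : a != b -> eigenproj A a *m eigenproj A b = 0.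
Proof.
move=> ab; apply/eqP; have : (b - a) *: (eigenproj A a *m eigenproj A b) = 0.
  have PA : eigenproj A a *m A *m eigenproj A b =
      a *: (eigenproj A a *m eigenproj A b).
    by rewrite mul_eigenprojl // -scalemxAl.
  by rewrite scalerBl -PA -mulmxA mul_eigenprojr -scalemxAr subrr.
by move/eqP; rewrite scaler_eq0 subr_eq0 eq_sym (negPf ab).
Qed.

Lemma eigenproj_idem a : eigenproj A a *m eigenproj A a = eigenproj A a.
Proof.
have [V Vu AV] := symmx_eigenbasis sA Al.
apply: (can_inj (mulmxK Vu)).
rewrite -mulmxA !(eigenproj_mulV _ sA AV) mulmxA (eigenproj_mulV _ sA AV).
rewrite -mulmxA mulmx_diag; congr (V *m diag_mx _).
by apply/rowP => i; rewrite !mxE; case: (l i == a); rewrite ?mulr0 ?mulr1.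
Qed.

(* Taking s = 1 and s = -1 gives lower and upper bounds. *)
Lemma quad_eigenproj (v : 'cV[R]_m) (b s : R) :
  (forall i, eigenproj A (l i) *m v != 0 -> s * b <= s * l i) ->
  s * b * (v^T *m v) 0 0 <= s * (v^T *m A *m v) 0 0.
Proof.
move=> lb; pose q i :=
  (\tr (eigenproj A (l i)))^-1 * (v^T *m eigenproj A (l i) *m v) 0 0.
have sumq : (v^T *m v) 0 0 = \sum_i q i.
  rewrite -[X in (_ *m X) 0 0]mul1mx -sum_eigenproj mulmxA mulmx_sumr mulmx_suml summxE.
  by apply: eq_bigr => i _; rewrite -scalemxAr -scalemxAl mxE.
have sumlq : (v^T *m A *m v) 0 0 = \sum_i l i * q i.
  rewrite -{1}[A]mulmx1 -sum_eigenproj mulmx_sumr mulmx_sumr mulmx_suml summxE.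
  apply: eq_bigr => i _.
  by rewrite -scalemxAr mul_eigenprojr -!scalemxAr -!scalemxAl 2!mxE mulrCA.
rewrite sumq sumlq !mulr_sumr; apply: ler_sum => i _; rewrite mulrA.
(* [q i] is a positive weight times the squared length of [P_i v]: it is nonnegative, and it
   vanishes whenever [lb] says nothing about [l i]. *)
have qE : q i = (eigenmult l (l i))%:R^-1 *
    \sum_k ((eigenproj A (l i) *m v) k 0) ^+ 2.
  rewrite /q mxtrace_eigenproj; congr (_ * _).
  rewrite -{1}eigenproj_idem mulmxA -mulmxA -{1}eigenproj_sym -trmx_mul mxE.
  by apply: eq_bigr => k _; rewrite mxE expr2.
have [Pv0|/lb] := eqVneq (eigenproj A (l i) *m v) 0.
  by rewrite qE big1 ?mulr0 // => k _; rewrite Pv0 mxE expr0n.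
apply: ler_wpM2r; rewrite qE mulr_ge0 ?invr_ge0 ?ler0n //.
by apply: sumr_ge0 => k _; exact: sqr_ge0.
Qed.

End Spectrum.

(** * Rayleigh bounds and Weyl's inequality *)

(* C sends a vector to its coordinates in an eigenbasis, so the first condition
   puts v in the span of the eigenvectors of index >= j, the second in the span
   of those of index <= j. *)
Lemma rayleigh_bounds A l (j : 'I_m) : A^T = A -> ordered_eigenvalues A l ->
  exists C : 'M[R]_m, forall v : 'cV[R]_m,
  ((forall k : 'I_m, (k < j)%N -> (C *m v) k 0 = 0) ->
     l j * (v^T *m v) 0 0 <= (v^T *m A *m v) 0 0) /\
  ((forall k : 'I_m, (j < k)%N -> (C *m v) k 0 = 0) ->
     (v^T *m A *m v) 0 0 <= l j * (v^T *m v) 0 0).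
Proof.
move=> sA [lmono Al]; have [V Vu AV] := symmx_eigenbasis sA Al.
exists (invmx V) => v.
(* The coordinate of [v] at [i] itself may vanish; a nonzero one exists only at some index with the
   same eigenvalue. *)
have Pv i : eigenproj A (l i) *m v != 0 ->
    exists2 k, l k = l i & (invmx V *m v) k 0 != 0.
  move=> Pv0; apply/not_exists2P => nex; case/negP: Pv0.
  rewrite -(mulKVmx Vu v) [X in X == _]mulmxA (eigenproj_mulV _ sA AV) -mulmxA.
  rewrite (_ : _ *m (invmx V *m v) = 0) ?mulmx0 //.
  apply/colP => k; rewrite mul_diag_mx !mxE.
  have [lki|] := eqVneq (l k) (l i); last by rewrite mul0r.
  have [/(_ lki)//|/negP/negPn/eqP] := nex k.
  by rewrite !mxE mul1r.
split=> Cv0.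
  have := @quad_eigenproj A l sA Al v (l j) 1; rewrite !mul1r; apply.
  move=> i /Pv[k lki Ck]; rewrite !mul1r -lki; apply: lmono; rewrite leqNgt.
  by apply: contraNN Ck => kj; rewrite Cv0.
have := @quad_eigenproj A l sA Al v (l j) (-1).
rewrite !mulN1r mulNr lerN2; apply.
move=> i /Pv[k lki Ck]; rewrite !mulN1r lerN2 -lki; apply: lmono; rewrite leqNgt.
by apply: contraNN Ck => kj; rewrite Cv0.
Qed.

(** Each product [|v_i v_k|] is at most [v^T v], because both squares are. The entrywise sum serves
    as a crude operator norm. *)
Lemma quad_le_sum (E : 'M[R]_m) (v : 'cV[R]_m) :
  (v^T *m E *m v) 0 0 <= (\sum_i \sum_k `|E i k|) * (v^T *m v) 0 0.
Proof.
have vv : (v^T *m v) 0 0 = \sum_k v k 0 ^+ 2.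
  by rewrite mxE; apply: eq_bigr => k _; rewrite mxE expr2.
rewrite vv -mulmxA mxE mulr_suml; apply: ler_sum => i _.
rewrite !mxE mulr_sumr mulr_suml; apply: ler_sum => k _.
rewrite (le_trans (ler_norm _)) // mulrCA normrM ler_wpM2l //.
have vle p : v p 0 ^+ 2 <= \sum_k v k 0 ^+ 2.
  by rewrite (bigD1 p) //= lerDl sumr_ge0 // => q _; exact: sqr_ge0.
have := vle i; have := vle k.
rewrite -[v i 0 ^+ 2]real_normK ?num_real // normrM.
rewrite -[v k 0 ^+ 2]real_normK ?num_real //; nra.
Qed.

(** One side of Weyl's inequality, by comparing the two quadratic forms at a common vector;
    exchanging [A] and [B] gives the other side. *)
Lemma eigenvalue_lipschitz A B l l' (j : 'I_m) : A^T = A -> B^T = B ->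
  ordered_eigenvalues A l -> ordered_eigenvalues B l' ->
  l j - l' j <= \sum_i \sum_k `|(A - B) i k|.
Proof.
move=> sA sB Al Bl.
have [C CP] := rayleigh_bounds j sA Al; have [D DP] := rayleigh_bounds j sB Bl.
(* Row j of M vanishes, so M kills some v != 0; the other rows make v satisfy
   the lower bound for A and the upper bound for B. *)
pose M : 'M[R]_m := \matrix_(k, i)
  (if (k < j)%N then C k i else if (j < k)%N then D k i else 0).
have /det0P[w w0 wM] : \det M^T == 0.
  rewrite det_tr (expand_det_row _ j) big1 // => i _.
  by rewrite mxE !ltnn mul0r.
pose v := w^T; have Mv : M *m v = 0 by rewrite -[M]trmxK -trmx_mul wM trmx0.
have rowM k : \sum_i M k i * v i 0 = 0 by have /colP/(_ k) := Mv; rewrite !mxE.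
have Av : l j * (v^T *m v) 0 0 <= (v^T *m A *m v) 0 0.
  apply: (CP v).1 => k kj; rewrite mxE -[RHS](rowM k).
  by apply: eq_bigr => i _; rewrite [M k i]mxE kj.
have Bv : (v^T *m B *m v) 0 0 <= l' j * (v^T *m v) 0 0.
  apply: (DP v).2 => k kj; rewrite mxE -[RHS](rowM k).
  by apply: eq_bigr => i _; rewrite [M k i]mxE kj ltnNge ltnW.
have vv0 : 0 < (v^T *m v) 0 0.
  rewrite lt_def; apply/andP; split; last first.
    by rewrite mxE sumr_ge0 // => k _; rewrite mxE -expr2 sqr_ge0.
  apply: contra w0 => /eqP vv; apply/eqP.
  apply: mulmx_trmx_eq0; apply/matrixP => a b; rewrite !ord1.
  by move: vv; rewrite /v trmxK => ->; rewrite mxE.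
rewrite -(ler_pM2r vv0); apply: le_trans (quad_le_sum (A - B) v).
rewrite mulmxBr mulmxBl [X in _ <= X]mxE [X in _ <= _ + X]mxE mulrBl.
exact: lerB.
Qed.

End Eigenprojections.

(** * The resolvent away from one eigenvalue *)

(** For symmetric [A], the part of the resolvent at [mu] that stays regular at [mu = l j], where it
    equals [reduced_resolvent A l j]. *)
Definition resolvent_off (R : realType) (m : nat) (A : 'M[R]_m) (l : 'I_m -> R)
    (j : 'I_m) (mu : R) : 'M[R]_m :=
  \sum_(i < m | l i != l j)
    (mu - l i)^-1 *: ((\tr (eigenproj A (l i)))^-1 *: eigenproj A (l i)).

Section Resolvent.
Context {R : realType} {m : nat} {A : 'M[R]_m} {l : 'I_m -> R}.
Hypotheses (sA : A^T = A) (Al : char_poly A = \prod_(i < m) ('X - (l i)%:P)).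
Variable j : 'I_m.

Lemma resolvent_off_sym mu : (resolvent_off A l j mu)^T = resolvent_off A l j mu.
Proof.
rewrite /resolvent_off linear_sum; apply: eq_bigr => i _.
by rewrite linearZ /= linearZ /= eigenproj_sym.
Qed.

Lemma resolvent_off_eigenproj mu : resolvent_off A l j mu *m eigenproj A (l j) = 0.
Proof.
rewrite /resolvent_off mulmx_suml big1 // => i lij.
by rewrite -!scalemxAl mul_eigenproj_neq // !scaler0.
Qed.

(** Since [P_i (mu - A) = (mu - l i) P_i], the scalar factors cancel. What remains is the resolution
    of the identity without the indices of eigenvalue [l j], whose terms add up to [P_j]. *)
Lemma mul_resolvent_off mu : (forall i, l i != l j -> mu != l i) ->
  resolvent_off A l j mu *m (mu%:M - A) = 1%:M - eigenproj A (l j).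
Proof.
move=> mul; rewrite /resolvent_off -(sum_eigenproj sA Al)
  [in RHS](bigID (fun i => l i == l j)) /=.
rewrite [X in X + _ - _](_ : _ = eigenproj A (l j)); last first.
  rewrite (eq_bigr (fun=> (eigenmult l (l j))%:R^-1 *: eigenproj A (l j))).
    rewrite sumr_const -[X in _ *+ X]/(eigenmult l (l j)).
    rewrite scalerMnl -[X in X *: _]mulr_natr mulVf ?scale1r //.
    by rewrite pnatr_eq0 -lt0n eigenmult_gt0.
  by move=> i /eqP ->; rewrite (mxtrace_eigenproj sA Al).
rewrite [X in X - _]addrC addrK mulmx_suml; apply: eq_bigr => i lij.
rewrite -!scalemxAl mulmxBr mul_mx_scalar mul_eigenprojl // -scalerBl.
rewrite !scalerA mulrAC mulVf ?mul1r //.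
  by rewrite subr_eq0 mul.
Qed.

End Resolvent.

(** * Comparison of two orthogonal projections *)

Section Projections.
Context {R : realType} {m : nat}.

Definition is_orthoproj (P : 'M[R]_m) := P^T = P /\ P *m P = P.

(** By [2 |a b| <= a^2 + b^2], an entry is at most the mean of two diagonal entries, each bounded by
    the trace. *)
Lemma norm_gram_le_trace p (G : 'M[R]_(m, p)) i k :
  `|(G *m G^T) i k| <= \tr (G *m G^T).
Proof.
have gram a b : (G *m G^T) a b = \sum_c G a c * G b c.
  by rewrite mxE; apply: eq_bigr => c _; rewrite mxE.
have sumtr : \tr (G *m G^T) = \sum_a \sum_c G a c ^+ 2.
  by apply: eq_bigr => a _; rewrite gram; under eq_bigr do rewrite -expr2.
have row_le a : \sum_c G a c ^+ 2 <= \tr (G *m G^T).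
  rewrite sumtr (bigD1 a) //= lerDl; apply: sumr_ge0 => b _.
  by apply: sumr_ge0 => c _; exact: sqr_ge0.
suff : `|(G *m G^T) i k| * 2 <= \sum_c G i c ^+ 2 + \sum_c G k c ^+ 2.
  move=> /le_trans/(_ (lerD (row_le i) (row_le k))); lra.
rewrite gram -big_split /= (le_trans (ler_wpM2r _ (ler_norm_sum _ _ _))) //.
rewrite mulr_suml; apply: ler_sum => c _.
rewrite normrM -[G i c ^+ 2]real_normK ?num_real //.
rewrite -[G k c ^+ 2]real_normK ?num_real //.
have := sqr_ge0 (`|G i c| - `|G k c|); nra.
Qed.

(** From [P = P P^T], a diagonal entry is the sum of squares of its row; it therefore dominates its
    own square, so it is at most 1, and it dominates [P i k ^+ 2]. *)
Lemma orthoproj_norm_le1 (P : 'M[R]_m) i k : is_orthoproj P -> `|P i k| <= 1.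
Proof.
move=> [sP PP].
have Psq a : P a a = \sum_c P a c ^+ 2.
  rewrite -{1}PP -{2}sP mxE; apply: eq_bigr => c _; rewrite mxE -expr2 //.
have sq_le a c : P a c ^+ 2 <= P a a.
  by rewrite Psq (bigD1 c) //= lerDl sumr_ge0 // => b _; exact: sqr_ge0.
have Pii : P i i <= 1 by have := sq_le i i; nra.
by rewrite -(@expr_le1 _ 2) // real_normK ?num_real // (le_trans (sq_le i k)).
Qed.

Lemma orthoproj_compl_gram (P P' : 'M[R]_m) : is_orthoproj P -> is_orthoproj P' ->
  P *m (1%:M - P') *m P = (P *m (1%:M - P')) *m (P *m (1%:M - P'))^T.
Proof.
move=> [sP PP] [sP' PP']; have sQ' : (1%:M - P')^T = 1%:M - P'.
  by rewrite linearB /= trmx1 sP'.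
rewrite trmx_mul sQ' sP mulmxA.
congr (_ *m _); rewrite -mulmxA; congr (_ *m _).
by rewrite mulmxBl mul1mx mulmxBr mulmx1 PP' subrr subr0.
Qed.

(** Block decomposition along [P] and [Q = 1 - P]: the transposed term is the block [P P' Q], and
    the last one is [P (P' - P) P]. *)
Lemma orthoproj_subE (P P' : 'M[R]_m) : is_orthoproj P -> is_orthoproj P' ->
  P' - P = (1%:M - P) *m P' + ((1%:M - P) *m P' *m P)^T - P *m (1%:M - P') *m P.
Proof.
move=> [sP PP] [sP' PP']; have sQ : (1%:M - P)^T = 1%:M - P.
  by rewrite linearB /= trmx1 sP.
rewrite !trmx_mul sQ sP sP'.
rewrite !(mulmxBl, mulmxBr, mul1mx, mulmx1) PP mulmxA.
move: (P *m P') (P *m P' *m P) => X Y.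
by apply/matrixP => i k; rewrite !mxE; lra.
Qed.

(** Both sides are a trace minus [\tr (P *m P')]. This is where constancy of the multiplicity
    enters. *)
Lemma mxtrace_orthoproj_compl (P P' : 'M[R]_m) : is_orthoproj P -> \tr P' = \tr P ->
  \tr (P *m (1%:M - P') *m P) = \tr ((1%:M - P) *m P').
Proof.
move=> [sP PP] tP; rewrite mxtrace_mulC mulmxA PP.
by rewrite mulmxBr mulmxBl mul1mx mulmx1 !linearB /= tP.
Qed.

End Projections.

(** * Limits of matrices and of projections *)

Section MatrixLimits.
Context {R : realType} {T : Type} {F : set_system T} {FF : Filter F}.

Lemma cvg_mxP {m n : nat} (f : T -> 'M[R]_(m, n)) (L : 'M[R]_(m, n)) :
  f @ F --> L <-> forall i k, f t i k @[t --> F] --> L i k.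
Proof.
split=> [fL i k|fL].
  exact: (@continuous_cvg _ _ _ _ _ f (fun M : 'M[R]_(m, n) => M i k) L
           (@coord_continuous R m n i k L) fL).
apply/cvgrPdist_le => eps eps0; near=> t.
rewrite /Num.Def.normr/= mx_normrE (bigmax_le _ (ltW eps0)) //= => i _.
rewrite !mxE; move: i; near: t; apply: filter_forall => /= i.
exact: ((cvgrPdist_le _ _).1 (fL i.1 i.2)).
Unshelve. all: by end_near. Qed.

Lemma cvg_bigsum {I : Type} (r : seq I) (Q : pred I) {V : normedModType R}
    (f : I -> T -> V) (L : I -> V) :
  (forall i, Q i -> f i @ F --> L i) ->
  \sum_(i <- r | Q i) f i t @[t --> F] --> \sum_(i <- r | Q i) L i.
Proof.
move=> fL; elim: r => [|i r IHr].
  rewrite big_nil; under eq_fun do rewrite big_nil; exact: cvg_cst.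
rewrite big_cons; under eq_fun do rewrite big_cons.
case: ifP => // Qi; apply: cvgD => //; exact: fL.
Qed.

Lemma cvg_mulmx {m n p : nat} (f : T -> 'M[R]_(m, n)) (g : T -> 'M[R]_(n, p))
    (L : 'M[R]_(m, n)) (M : 'M[R]_(n, p)) :
  f @ F --> L -> g @ F --> M -> f t *m g t @[t --> F] --> L *m M.
Proof.
move=> /cvg_mxP fL /cvg_mxP gM; apply/cvg_mxP => i k; rewrite mxE.
under eq_fun do rewrite mxE.
by apply: cvg_bigsum => c _; exact: cvgM.
Qed.

Lemma cvg_trmx {m n : nat} (f : T -> 'M[R]_(m, n)) (L : 'M[R]_(m, n)) :
  f @ F --> L -> (f t)^T @[t --> F] --> L^T.
Proof.
move=> /cvg_mxP fL; apply/cvg_mxP => i k; rewrite mxE.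
by under eq_fun do rewrite mxE; exact: fL.
Qed.

Lemma cvg_mxtrace {m : nat} (f : T -> 'M[R]_m) (L : 'M[R]_m) :
  f @ F --> L -> \tr (f t) @[t --> F] --> \tr L.
Proof. by move=> /cvg_mxP fL; apply: cvg_bigsum => i _; exact: fL. Qed.

(** Entries of projections are bounded by 1, so [P] need not converge; this allows its use before
    continuity of the eigenprojection is known. *)
Lemma cvg_mulmx_orthoproj {m : nat} (f P : T -> 'M[R]_m) :
  f @ F --> (0 : 'M[R]_m) -> (\forall t \near F, is_orthoproj (P t)) ->
  f t *m P t @[t --> F] --> (0 : 'M[R]_m).
Proof.
move=> /cvg_mxP f0 Pt; apply/cvg_mxP => i k; rewrite mxE.
apply/cvgr0Pnorm_le => eps eps0.
have fle : \sum_c `|f t i c| @[t --> F] --> \sum_(c < m) (0 : R).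
  apply: cvg_bigsum => c _; have := f0 i c; rewrite mxE => /cvg_norm.
  by rewrite normr0.
rewrite big1_eq in fle; move/cvgr0Pnorm_le : fle => /(_ _ eps0).
apply: filterS2 Pt => t Pt fle.
rewrite (le_trans _ fle) // [leRHS]ger0_norm ?sumr_ge0 // mxE.
rewrite (le_trans (ler_norm_sum _ _ _)) // ler_sum // => c _.
by rewrite normrM ler_piMr // orthoproj_norm_le1.
Qed.

(** Applied twice: with [s = 1] and [L = 0] for continuity, then with [s = h^-1] for the
    derivative. *)
Lemma cvg_orthoproj_sub {m : nat} (P : 'M[R]_m) (P' : T -> 'M[R]_m) (s : T -> R)
    (L : 'M[R]_m) :
  is_orthoproj P ->
  (\forall t \near F, is_orthoproj (P' t) /\ \tr (P' t) = \tr P) ->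
  s t *: ((1%:M - P) *m P' t) @[t --> F] --> L -> \tr L = 0 ->
  s t *: (P' t - P) @[t --> F] --> L + (L *m P)^T.
Proof.
move=> oP oP' sL L0.
pose N t := s t *: (P *m (1%:M - P' t) *m P).
(* Entries of [N t] are at most [|s t|] times the trace of a Gram matrix, that is, the absolute
   trace of [s t *: (Q P')], which tends to [\tr L = 0]. *)
have N0 : N @ F --> (0 : 'M[R]_m).
  apply/cvg_mxP => i k; rewrite mxE; apply/cvgr0Pnorm_le => eps eps0.
  have := cvg_mxtrace sL; rewrite L0 => /cvgr0Pnorm_le/(_ _ eps0).
  apply: filterS2 oP' => t [oP't tP'] le_eps; apply: le_trans le_eps.
  rewrite /N mxtraceZ -(mxtrace_orthoproj_compl oP tP') mxE !normrM.
  rewrite ler_wpM2l // (orthoproj_compl_gram oP oP't).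
  by rewrite (le_trans (norm_gram_le_trace _ _ _)) // ler_norm.
have lim : s t *: ((1%:M - P) *m P' t) + (s t *: ((1%:M - P) *m P' t) *m P)^T
    - N t @[t --> F] --> L + (L *m P)^T.
  rewrite -[L + _]subr0; apply: (cvgB _ N0); apply: (cvgD sL); apply: cvg_trmx.
  by apply: (cvg_mulmx sL); exact: cvg_cst.
apply: cvg_trans lim; apply: near_eq_cvg.
apply: filterS oP' => t [oP't _] /=.
rewrite (orthoproj_subE oP oP't) scalerBr scalerDr -scalemxAl.
by rewrite [X in _ + X - _]linearZ.
Qed.

End MatrixLimits.

(** * Directional derivatives of continuously differentiable maps *)

(** Stated for [s] of either sign, as two-sided limits and arbitrary coefficients require. *)
Lemma MVT_centered (R : realType) (f : R -> R) (s : R) :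
  (forall t, `|t| <= `|s| -> derivable f t 1) ->
  exists2 xi, `|xi| <= `|s| & f s - f 0 = s * 'D_1 f xi.
Proof.
move=> df.
have is_df (t : R) : `|t| <= `|s| -> is_derive t 1 f ('D_1 f t).
  by move=> /df/derivableP.
have cf (a b : R) : (forall t, t \in `[a, b]%R -> `|t| <= `|s|) ->
    {within `[a, b], continuous f}.
  by move=> ab; apply: derivable_within_continuous => t /ab/df.
have [s0|s0] := leP 0 s.
- have abs (t : R) : t \in `[0, s]%R -> `|t| <= `|s|.
    by rewrite in_itv /= => /andP[t0 ts]; rewrite !ger0_norm.
  have [||xi xis ->] := @MVT_segment _ f ('D_1 f) 0 s s0.
  + by move=> t /subset_itv_oo_cc/abs/is_df.
  + exact: cf.
  by exists xi; [exact: abs | rewrite subr0 mulrC].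
- have abs (t : R) : t \in `[s, 0]%R -> `|t| <= `|s|.
    by rewrite in_itv /= => /andP[st t0]; rewrite (ler0_norm t0) (ltr0_norm s0) lerN2.
  have [||xi xis e] := @MVT_segment _ f ('D_1 f) s 0 (ltW s0).
  + by move=> t /subset_itv_oo_cc/abs/is_df.
  + exact: cf.
  by exists xi; [exact: abs | rewrite -opprB e sub0r mulrN opprK mulrC].
Qed.

Lemma derive_lineE (R : realType) (V W : normedModType R) (f : V -> W)
    (z v : V) (t : R) :
  (derivable (fun s : R => f (z + s *: v)) t 1 <-> derivable f (z + t *: v) v) /\
  'D_1 (fun s : R => f (z + s *: v)) t = 'D_v f (z + t *: v).
Proof.
rewrite /derivable /derive.
suff -> : (fun h : R => h^-1 *:
    (((fun s : R => f (z + s *: v)) \o shift t) (h *: 1) - f (z + t *: v))) =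
  (fun h : R => h^-1 *: ((f \o shift (z + t *: v)) (h *: v) - f (z + t *: v))) by [].
apply/funext => h /=; congr (_ *: (f _ - _)).
by rewrite /shift /= [h *: 1]mulr1 scalerDl addrCA addrC.
Qed.

(** The base point [x + h *: u] moves with [h], so derivability at [x] alone is not enough; the mean
    value theorem along [v] and continuity of the derivative give the limit. *)
Lemma cvg_partial_increment (R : realType) (V : normedModType R) (Omega : set V)
    (f : V -> R) (x u v : V) (c : R) :
  open Omega -> Omega x -> (forall y, Omega y -> derivable f y v) ->
  {within Omega, continuous (fun y => 'D_v f y)} ->
  h^-1 *: (f (x + h *: (u + c *: v)) - f (x + h *: u)) @[h --> 0^'] --> c * 'D_v f x.
Proof.
move=> oO Ox df cdf; apply/cvgrPdist_le => eps eps0.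
(* The final error is [|c|] times this bound; adding 1 also covers [c = 0]. *)
have e'0 : 0 < eps / (`|c| + 1) by rewrite divr_gt0 // ltr_wpDl.
have : \forall y \near x, Omega y /\ `|'D_v f x - 'D_v f y| <= eps / (`|c| + 1).
  apply: filterI; first exact: open_nbhs_nbhs.
  move: cdf; rewrite continuous_open_subspace // => /(_ x).
  by rewrite inE => /(_ Ox)/cvgrPdist_le/(_ _ e'0).
move=> /nbhs_ballP[r /= r0 ballr].
(* For smaller [|h|], the whole segment from [x + h *: u] to [x + h *: (u + c *: v)] stays in the
   ball. *)
have r'0 : 0 < r / (`|u| + `|c| * `|v| + 1).
  by rewrite divr_gt0 // ltr_wpDl // addr_ge0 // mulr_ge0.
near=> h.
have h0 : h != 0 by near: h; exact: nbhs_dnbhs_neq.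
have hr : `|h| * (`|u| + `|c| * `|v| + 1) < r.
  rewrite -ltr_pdivlMr ?ltr_wpDl ?addr_ge0 ?mulr_ge0 //.
  by near: h; exact: dnbhs0_lt.
have inball t : `|t| <= `|h * c| -> Omega (x + h *: u + t *: v) /\
    `|'D_v f x - 'D_v f (x + h *: u + t *: v)| <= eps / (`|c| + 1).
  move=> tc; apply: ballr; rewrite -ball_normE /= -addrA opprD addNKr normrN.
  apply: le_lt_trans hr; rewrite (le_trans (ler_normD _ _)) //.
  have := ler_wpM2r (normr_ge0 v) tc; rewrite !normrZ ?normrM.
  have := normr_ge0 h; lra.
have [xi xic] : exists2 xi, `|xi| <= `|h * c| &
    f (x + h *: u + (h * c) *: v) - f (x + h *: u + 0 *: v) =
    h * c * 'D_1 (fun s : R => f (x + h *: u + s *: v)) xi.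
  apply: (@MVT_centered _ (fun s : R => f (x + h *: u + s *: v))) => t tc.
  by apply: (derive_lineE _ _ _ _).1.2; apply: df; exact: (inball t tc).1.
rewrite (derive_lineE _ _ _ _).2 scale0r addr0 => incr.
rewrite [h *: (u + _)]scalerDr scalerA addrA incr.
rewrite [_ *: _]mulrA mulrA mulVf // mul1r -mulrBr normrM.
rewrite (le_trans (ler_wpM2l _ (inball xi xic).2)) //.
rewrite mulrA ler_pdivrMr ?ltr_wpDl // mulrC.
by rewrite ler_wpM2l ?lerDl // ltW.
Unshelve. all: by end_near. Qed.

Lemma C1_derivable_real (R : realType) (n : nat) (Omega : set 'rV[R]_n)
    (f : 'rV[R]_n -> R) (x e : 'rV[R]_n) :
  open Omega -> is_C1 Omega f -> Omega x -> derivable f x e.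
Proof.
(* Quantifying over [u] makes [P] stable under sums, so the coordinates of [e] can be added one at a
   time. *)
move=> oO C1f Ox; pose P v := forall u, derivable f x u -> derivable f x (u + v).
suff Pe : P e by rewrite -[e]add0r; apply: Pe; exact: derivable0.
rewrite (row_sum_delta e); apply: (big_ind P).
- by move=> u; rewrite addr0.
- by move=> v w Pv Pw u du; rewrite addrA; exact/Pw/Pv.
move=> k _ u /cvg_ex[/= L fuL].
have [dfk cfk] := C1f k.
have incr := @cvg_partial_increment _ _ _ f x u (delta_mx 0 k) (e 0 k) oO Ox dfk cfk.
apply/cvg_ex; exists (e 0 k * 'D_(delta_mx 0 k) f x + L).
have lim : h^-1 *: (f (x + h *: (u + e 0 k *: delta_mx 0 k)) - f (x + h *: u)) +
    h^-1 *: (f (h *: u + x) - f x) @[h --> 0^'] --> e 0 k * 'D_(delta_mx 0 k) f x + L.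
  exact: (cvgD incr fuL).
apply: cvg_trans lim; apply: near_eq_cvg; near=> h.
rewrite /= -scalerDr /shift /=; congr (_ *: _).
by rewrite ![_ + x]addrC addrA addrNK.
Unshelve. all: by end_near. Qed.

Lemma C1_derivable (R : realType) (n p q : nat) (Omega : set 'rV[R]_n)
    (F : 'rV[R]_n -> 'M[R]_(p, q)) (x e : 'rV[R]_n) :
  open Omega -> is_C1 Omega F -> Omega x -> derivable F x e.
Proof.
move=> oO C1F Ox; apply/derivable_mxP => i k.
apply: (C1_derivable_real oO _ Ox) => c; have [dF cF] := C1F c.
split=> [y /dF /derivable_mxP//|].
move: cF; rewrite !continuous_open_subspace // => cF y yO.
have Oy : Omega y by rewrite inE in yO.
have lim : 'D_(delta_mx 0 c) F z i k @[z --> y] --> 'D_(delta_mx 0 c) F y i k.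
  exact: ((cvg_mxP _ _).1 (cF y yO)).
rewrite derive_mx ?mxE in lim; last exact: dF.
apply: cvg_trans lim; apply: (@near_eq_cvg _ _ (nbhs y)).
apply: filterS (open_nbhs_nbhs (conj oO Oy)) => z Oz.
by rewrite derive_mx ?mxE //; exact: dF.
Qed.

(** * Convergence of eigenvalues and resolvents *)

Lemma eigenproj_is_orthoproj (R : realType) (m : nat) (A : 'M[R]_m) (l : 'I_m -> R) a :
  A^T = A -> char_poly A = \prod_(i < m) ('X - (l i)%:P) ->
  is_orthoproj (eigenproj A a).
Proof.
by move=> sA Al; split; [exact: eigenproj_sym | exact: (eigenproj_idem sA Al)].
Qed.

Section EigenvalueLimits.
Context {R : realType} {m : nat} {T : Type} {F : set_system T} {FF : Filter F}.
Variables (A : 'M[R]_m) (l : 'I_m -> R) (B : T -> 'M[R]_m) (k : T -> 'I_m -> R).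
Hypotheses (sA : A^T = A) (Al : ordered_eigenvalues A l).
Hypothesis Bk : \forall t \near F, (B t)^T = B t /\ ordered_eigenvalues (B t) (k t).
Hypothesis BA : B @ F --> A.
Variable j : 'I_m.

Lemma cvg_eigenvalue : k t j @[t --> F] --> l j.
Proof.
have sum0 : \sum_i \sum_c `|(A - B t) i c| @[t --> F] -->
    \sum_(i < m) \sum_(c < m) (0 : R).
  apply: cvg_bigsum => i _; apply: cvg_bigsum => c _.
  have /cvg_mxP/(_ i c) : A - B t @[t --> F] --> A - A.
    by apply: cvgB => //; exact: cvg_cst.
  by rewrite subrr mxE => /cvg_norm; rewrite normr0.
rewrite [X in _ --> X]big1 in sum0; last by move=> i _; rewrite big1.
apply/cvgrPdist_le => eps eps0.
have /cvgr0Pnorm_le/(_ _ eps0) := sum0.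
apply: filterS2 Bk => t [sB Bkt]; apply: le_trans.
rewrite [leRHS]ger0_norm; last by do 2![apply: sumr_ge0 => ? _].
rewrite ler_norml lerNl opprB; apply/andP; split; last exact: eigenvalue_lipschitz.
rewrite (le_trans (eigenvalue_lipschitz j sB sA Bkt Al)) //.
by apply: ler_sum => i _; apply: ler_sum => c _; rewrite -opprB mxE normrN.
Qed.

Lemma cvg_resolvent_off :
  resolvent_off A l j (k t j) @[t --> F] --> reduced_resolvent A l j.
Proof.
apply: cvg_bigsum => i lij; apply: cvgZ; last exact: cvg_cst.
apply: cvgV.
  by rewrite subr_eq0 eq_sym.
by apply: cvgB; [exact: cvg_eigenvalue | exact: cvg_cst].
Qed.

Lemma near_compl_eigenproj : \forall t \near F,
  (1%:M - eigenproj A (l j)) *m eigenproj (B t) (k t j) =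
  resolvent_off A l j (k t j) *m (B t - A) *m eigenproj (B t) (k t j).
Proof.
have away : \forall t \near F, forall i, l i != l j -> k t j != l i.
  apply: filter_forall => i; have [lij|lij] := eqVneq (l i) (l j).
    by apply: nearW.
  have lim : k t j - l i @[t --> F] --> l j - l i.
    by apply: cvgB; [exact: cvg_eigenvalue | exact: cvg_cst].
  have lij0 : l j - l i != 0 by rewrite subr_eq0 eq_sym.
  by apply: filterS (cvgr_neq0 _ lim lij0) => t; rewrite subr_eq0.
apply: filterS away => t awayt.
(* Write [P'] for the eigenprojection of [B t] at [k t j]. As [B t *m P'] is [k t j *: P'], the
   factor [k t j - A] acts on [P'] as [B t - A]. *)
rewrite -(mul_resolvent_off sA Al.2 awayt) -!mulmxA; congr (_ *m _).
by rewrite !mulmxBl mul_scalar_mx (mul_eigenprojr (B t)).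
Qed.

End EigenvalueLimits.

(** * Derivative of the eigenprojection *)

Theorem theorem3p2 (R : realType) (n m : nat) (Omega : set 'rV[R]_n)
    (H : 'rV[R]_n -> 'M[R]_m) (lam : 'rV[R]_n -> 'I_m -> R) (j : 'I_m) :
  is_domain Omega ->
  (forall x, Omega x -> (H x)^T = H x) ->
  is_C1 Omega H ->
  (forall x, Omega x -> ordered_eigenvalues (H x) (lam x)) ->
  let P := fun (i : 'I_m) (x : 'rV[R]_n) => eigenproj (H x) (lam x i) in
  let A := fun x : 'rV[R]_n => reduced_resolvent (H x) (lam x) j in
  (forall x y, Omega x -> Omega y -> \tr (P j x) = \tr (P j y)) ->
  forall x (e : 'rV[R]_n), Omega x ->
    derivable (P j) x e /\
    'D_e (P j) x = P j x *m 'D_e H x *m A x + A x *m 'D_e H x *m P j x.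
Proof.
move=> [_ oO _] sH C1H Hlam P A trP x e Ox.
set D := 'D_e H x.
have dH : h^-1 *: (H (h *: e + x) - H x) @[h --> 0^'] --> D.
  have /cvg_ex[/= D' dH] : derivable H x e := C1_derivable oO C1H Ox.
  by have -> : D = D' by exact: (cvg_lim _ dH).
have lineO : \forall h \near (0 : R)^', Omega (h *: e + x).
  have lim : h *: e + x @[h --> (0 : R)^'] --> 0 *: e + x.
    apply: cvgD; last exact: cvg_cst.
    by apply: cvgZ; [exact: cvg_within | exact: cvg_cst].
  by rewrite scale0r add0r in lim; apply: lim; exact: open_nbhs_nbhs.
(* Continuity along the line, from [h] times a convergent difference quotient. *)
have Hx : H (h *: e + x) @[h --> (0 : R)^'] --> H x.
  have lim : h *: (h^-1 *: (H (h *: e + x) - H x)) + H x @[h --> (0 : R)^'] -->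
      0 *: D + H x.
    by apply: cvgD; [apply: cvgZ => //; exact: cvg_within | exact: cvg_cst].
  rewrite scale0r add0r in lim.
  apply: cvg_trans lim; apply: (@near_eq_cvg _ _ (0 : R)^').
  near=> h; rewrite scalerA mulfV ?scale1r ?subrK //.
  by near: h; exact: nbhs_dnbhs_neq.
have nearH : \forall h \near (0 : R)^', (H (h *: e + x))^T = H (h *: e + x) /\
    ordered_eigenvalues (H (h *: e + x)) (lam (h *: e + x)).
  by apply: filterS lineO => h Oh; split; [exact: sH | exact: Hlam].
have oP y : Omega y -> is_orthoproj (P j y).
  by move=> Oy; exact: eigenproj_is_orthoproj (sH _ Oy) (Hlam _ Oy).2.
have nearP : \forall h \near (0 : R)^', is_orthoproj (P j (h *: e + x)) /\
    \tr (P j (h *: e + x)) = \tr (P j x).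
  by apply: filterS lineO => h Oh; split; [exact: oP | exact: trP].
pose S h := resolvent_off (H x) (lam x) j (lam (h *: e + x) j).
have limS : S h @[h --> (0 : R)^'] --> A x.
  exact: (cvg_resolvent_off (sH _ Ox) (Hlam _ Ox) nearH Hx).
have nearQP : \forall h \near (0 : R)^', (1%:M - P j x) *m P j (h *: e + x) =
    S h *m (H (h *: e + x) - H x) *m P j (h *: e + x).
  exact: (near_compl_eigenproj (sH _ Ox) (Hlam _ Ox) nearH Hx).
have limQP : 1 *: ((1%:M - P j x) *m P j (h *: e + x)) @[h --> (0 : R)^'] -->
    (0 : 'M[R]_m).
  have lim : S h *m (H (h *: e + x) - H x)
      *m P j (h *: e + x) @[h --> (0 : R)^'] --> (0 : 'M[R]_m).
    apply: cvg_mulmx_orthoproj; last by apply: filterS nearP => h [].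
    rewrite -(mulmx0 _ (A x)) -(subrr (H x)); apply: cvg_mulmx => //.
    by apply: cvgB => //; exact: cvg_cst.
  apply: cvg_trans lim; apply: (@near_eq_cvg _ _ (0 : R)^').
  by apply: filterS nearQP => h ->; rewrite scale1r.
have limP : P j (h *: e + x) @[h --> (0 : R)^'] --> P j x.
  have lim : 1 *: (P j (h *: e + x) - P j x) + P j x @[h --> (0 : R)^'] -->
      0 + (0 *m P j x)^T + P j x.
    apply: cvgD; last exact: cvg_cst.
    apply: cvg_orthoproj_sub; first exact: oP.
    - exact: nearP.
    - exact: limQP.
    - exact: mxtrace0.
  rewrite mul0mx trmx0 addr0 add0r in lim.
  apply: cvg_trans lim; apply: (@near_eq_cvg _ _ (0 : R)^').
  by near=> h; rewrite scale1r subrK.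
have limdQP : h^-1 *: ((1%:M - P j x) *m P j (h *: e + x)) @[h --> 0^'] -->
    A x *m D *m P j x.
  have lim : S h *m
      (h^-1 *: (H (h *: e + x) - H x)) *m P j (h *: e + x)
      @[h --> 0^'] --> A x *m D *m P j x.
    by apply: cvg_mulmx => //; exact: cvg_mulmx.
  apply: cvg_trans lim; apply: (@near_eq_cvg _ _ (0 : R)^').
  by apply: filterS nearQP => h ->; rewrite -scalemxAr -scalemxAl.
(* [A x] is by conversion [resolvent_off] at [mu = lam x j], so the lemmas on the latter apply to
   it. *)
have sA : (A x)^T = A x by exact: resolvent_off_sym.
have AP0 : A x *m P j x = 0 by exact: resolvent_off_eigenproj (sH _ Ox) _ _.
have [sP PP] := oP _ Ox.
have sD : D^T = D.
  have limT : h^-1 *: (H (h *: e + x) - H x) @[h --> 0^'] --> D^T.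
    apply: cvg_trans (cvg_trmx dH); apply: (@near_eq_cvg _ _ (0 : R)^').
    by apply: filterS lineO => h Oh; rewrite linearZ /= linearB /= !sH.
  exact: (cvg_unique _ limT dH).
(* By cyclicity the trace contains the factor [P A = (A P)^T = 0]. *)
have trL : \tr (A x *m D *m P j x) = 0.
  by rewrite mxtrace_mulC mulmxA -[P j x *m A x]trmxK
    trmx_mul sA sP AP0 trmx0 mul0mx mxtrace0.
have LP : (A x *m D *m P j x *m P j x)^T = P j x *m D *m A x.
  by rewrite -[X in X^T]mulmxA PP trmx_mul [(A x *m D)^T]trmx_mul sP sA sD mulmxA.
have dP : h^-1 *: (P j (h *: e + x) - P j x) @[h --> 0^'] -->
    P j x *m D *m A x + A x *m D *m P j x.
  rewrite addrC -LP.
  apply: cvg_orthoproj_sub; first exact: oP.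
  - exact: nearP.
  - exact: limdQP.
  - exact: trL.
split; first exact: cvgP dP.
exact: (cvg_lim _ dP).
Unshelve. all: by end_near. Qed.
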